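(* Suppose $k\ge 3$ and $\sigma$ is a restrictive permutation of length $k$. Then for all $n\ge 0$ we have $$|F_n(123,\sigma)|=\sum_{j=0}^{k-1}\binom{n-1}{j}.$$
   Context: A permutation contains a pattern $\sigma$ if some subsequence of it has the same length and relative order as $\sigma$; otherwise it avoids $\sigma$. A copy of the Fishburn pattern $f$ in a permutation $\pi$ (in one-line notation) is a subsequence $\pi_j,\pi_{j+1},\pi_k$ with $j+1<k$, $\pi_j=\pi_k+1$, and $\pi_{j+1}>\pi_j$; a Fishburn permutation is one with no copy of $f$. $F_n(\sigma_1,\dots,\sigma_m)$ is the set of Fishburn permutations of length $n$ avoiding each $\sigma_i$. A permutation $\sigma$ is restrictive if $\sigma$ avoids $123$, $\sigma$ contains $f$, and $\sigma$ avoids both $2413$ and $3412$. For $n=0$ the convention $\binom{-1}{0}=1$ and $\binom{-1}{j}=0$ for $j\ge1$ is used. *)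

(* Defs.v *)
From mathcomp Require Import all_boot all_fingroup.
Set Implicit Arguments.
Unset Strict Implicit.
Unset Printing Implicit Defensive.

(* Permutations of length n are elements of 'S_n.  Since 'I_n = {0, .., n-1},
   the letters of the one-line notation are shifted by one to be 1, .., n. *)
Definition one_line (n : nat) (p : 'S_n) : seq nat :=
  [seq (p i).+1 | i <- enum 'I_n].

Definition same_relative_order (u v : seq nat) : bool :=
  (size u == size v) &&
  [forall i : 'I_(size u), forall j : 'I_(size u),
     (nth 0 u i < nth 0 u j) == (nth 0 v i < nth 0 v j)].

(* The subsequences of w are exactly the [mask m w], m a bit mask on w. *)
Definition contains (s w : seq nat) : bool :=
  [exists m : (size w).-tuple bool, same_relative_order (mask m w) s].

Definition avoids (s w : seq nat) : bool := ~~ contains s w.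

(* Positions are numbered from 0; a copy is w_j, w_(j+1), w_l. *)
Definition contains_fishburn (w : seq nat) : bool :=
  [exists j : 'I_(size w), exists l : 'I_(size w),
     [&& j.+1 < l, nth 0 w j == nth 0 w l + 1 & nth 0 w j < nth 0 w j.+1]].

Definition fishburn_avoiding (n : nat) (patterns : seq (seq nat)) : {set 'S_n} :=
  [set p : 'S_n | ~~ contains_fishburn (one_line p)
                  & all (fun s => avoids s (one_line p)) patterns].

Definition restrictive (k : nat) (sigma : 'S_k) : bool :=
  [&& avoids [:: 1; 2; 3] (one_line sigma),
      contains_fishburn (one_line sigma),
      avoids [:: 2; 4; 1; 3] (one_line sigma)
    & avoids [:: 3; 4; 1; 2] (one_line sigma)].

(* The binomial coefficient (n-1 choose j), with (-1 choose 0) = 1 and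
   (-1 choose j) = 0 for j >= 1. *)
Definition bin_pred (n j : nat) : nat :=
  if n is n'.+1 then 'C(n', j) else (if j is 0 then 1 else 0).

(* Main.v *)
Require Import Defs.
From mathcomp Require Import all_boot all_fingroup.
From mathcomp Require Import zify.

(* In a 123-avoiding Fishburn permutation the bottom x of an ascent is a
   left-to-right minimum, so x - 1 would have to come later and create a copy of
   f unless x = 1.  Hence such a permutation is A 1 B with A and B decreasing, and
   it is encoded by the binary word of length n - 1 that records which of the
   letters 2, .., n lie in A.  Two disjoint ascents produce 123, 2413 or 3412, so
   a restrictive sigma is a union of two decreasing runs too, but its only ascent
   has a bottom different from 1.  Therefore an occurrence of sigma in A 1 B cannot
   use the letter 1, and it must put the two runs of sigma into A and B: it exists
   iff the binary word of sigma is a subsequence of that of A 1 B.  The number of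
   binary words avoiding a given subsequence depends only on its length. *)

(** * Subsequences and pattern containment *)

Lemma subseq_catP (T : eqType) (u a b : seq T) :
  subseq u (a ++ b) -> exists a' b', [/\ u = a' ++ b', subseq a' a & subseq b' b].
Proof.
case/subseqP => m sz_m ->; exists (mask (take (size a) m) a), (mask (drop (size a) m) b).
split; try exact: mask_subseq.
rewrite -{1}(cat_take_drop (size a) m) mask_cat // size_takel // sz_m size_cat.
exact: leq_addr.
Qed.

Lemma subseq_nths (w s : seq nat) :
  sorted ltn s -> all (gtn (size w)) s -> subseq [seq nth 0 w i | i <- s] w.
Proof.
move=> s_sorted s_lt; rewrite -{2}(mkseq_nth 0 w); apply: map_subseq.
(* A strictly increasing list of positions is determined by its set of members, so it is a filter of
   [iota 0 (size w)]. *)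
have -> : s = [seq i <- iota 0 (size w) | i \in s].
  apply: (irr_sorted_eq ltn_trans ltnn) => //.
    exact/(sorted_filter ltn_trans)/iota_ltn_sorted.
  move=> i; rewrite mem_filter mem_iota /= add0n; case i_s: (i \in s) => //=.
  by symmetry; exact: (allP s_lt i i_s).
exact: filter_subseq.
Qed.

Lemma containsP (s w : seq nat) :
  reflect (exists2 u, subseq u w & same_relative_order u s) (contains s w).
Proof.
apply: (iffP existsP) => [[m mP]|[u /subseqP[m /eqP sz_m ->] uP]].
  by exists (mask m w) => //; exact: mask_subseq.
by exists (Tuple sz_m).
Qed.

Lemma same_relative_orderP (u v : seq nat) :
  reflect (size u = size v /\ forall i j, i < size u -> j < size u ->
             (nth 0 u i < nth 0 u j) = (nth 0 v i < nth 0 v j))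
          (same_relative_order u v).
Proof.
apply: (iffP andP) => [[/eqP sz /forallP uvP]|[sz uvP]]; split=> //; last 1 first.
- by apply/forallP => i; apply/forallP => j; rewrite uvP.
- move=> i j lti ltj.
  by have /forallP/(_ (Ordinal ltj))/eqP := uvP (Ordinal lti).
- exact/eqP.
Qed.

Lemma same_relative_order_map (f g : nat -> nat) (s : seq nat) :
  {in s &, forall x y, (f x < f y) = (g x < g y)} ->
  same_relative_order (map f s) (map g s).
Proof.
move=> fgP; apply/same_relative_orderP; rewrite !size_map; split=> // i j lti ltj.
by rewrite !(nth_map 0) // fgP // mem_nth.
Qed.

(** * Ascents and the patterns 123, 2413 and 3412 *)

Lemma contains_123 (w : seq nat) (i j l : nat) :
  i < j -> j < l -> l < size w ->
  nth 0 w i < nth 0 w j -> nth 0 w j < nth 0 w l -> contains [:: 1; 2; 3] w.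
Proof.
move=> ltij ltjl ltl lt1 lt2; apply/containsP.
exists [seq nth 0 w x | x <- [:: i; j; l]].
  by apply: subseq_nths => /=; lia.
apply/same_relative_orderP; split=> //= x y.
by case: x => [|[|[|x]]] // _; case: y => [|[|[|y]]] //= _; lia.
Qed.

Lemma contains_2413 (w : seq nat) (i j l h : nat) :
  i < j -> j < l -> l < h -> h < size w ->
  nth 0 w l < nth 0 w i -> nth 0 w i < nth 0 w h -> nth 0 w h < nth 0 w j ->
  contains [:: 2; 4; 1; 3] w.
Proof.
move=> ltij ltjl ltlh lth lt1 lt2 lt3; apply/containsP.
exists [seq nth 0 w x | x <- [:: i; j; l; h]].
  by apply: subseq_nths => /=; lia.
apply/same_relative_orderP; split=> //= x y.
by case: x => [|[|[|[|x]]]] // _; case: y => [|[|[|[|y]]]] //= _; lia.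
Qed.

Lemma contains_3412 (w : seq nat) (i j l h : nat) :
  i < j -> j < l -> l < h -> h < size w ->
  nth 0 w l < nth 0 w h -> nth 0 w h < nth 0 w i -> nth 0 w i < nth 0 w j ->
  contains [:: 3; 4; 1; 2] w.
Proof.
move=> ltij ltjl ltlh lth lt1 lt2 lt3; apply/containsP.
exists [seq nth 0 w x | x <- [:: i; j; l; h]].
  by apply: subseq_nths => /=; lia.
apply/same_relative_orderP; split=> //= x y.
by case: x => [|[|[|[|x]]]] // _; case: y => [|[|[|[|y]]]] //= _; lia.
Qed.

(** Overlapping ascents form 123. For disjoint ones, avoiding 123 puts [w_j] below [w_i] and
    [w_(j+1)] below [w_(i+1)]; comparing [w_i] with [w_(j+1)] then yields 2413 or 3412. *)
Lemma unique_ascent (w : seq nat) (i j : nat) :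
  uniq w -> avoids [:: 1; 2; 3] w -> avoids [:: 2; 4; 1; 3] w ->
  avoids [:: 3; 4; 1; 2] w -> i < j -> j.+1 < size w ->
  nth 0 w i < nth 0 w i.+1 -> nth 0 w j < nth 0 w j.+1 -> False.
Proof.
move=> w_uniq /negP no123 /negP no2413 /negP no3412 ltij ltj asci ascj.
have neqs x y : x < y -> y < size w -> nth 0 w x != nth 0 w y.
  by move=> ltxy lty; rewrite nth_uniq ?(ltn_trans ltxy lty) // ltn_eqF.
have [eqj|neqj] := eqVneq j i.+1.
  by subst j; case: no123; apply: (@contains_123 _ i i.+1 i.+2).
have no_between x y z : x < y -> y < z -> z < size w -> nth 0 w x < nth 0 w y ->
    nth 0 w z <= nth 0 w y.
  move=> *; rewrite leqNgt; apply/negP => lt2.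
  by case: no123; apply: (@contains_123 _ x y z).
have le1 : nth 0 w j.+1 <= nth 0 w i.+1 by apply: (no_between i); lia.
have ne1 : nth 0 w i.+1 != nth 0 w j.+1 by apply: neqs; lia.
have ne2 : nth 0 w i != nth 0 w j.+1 by apply: neqs; lia.
have ne3 : nth 0 w i != nth 0 w j by apply: neqs; lia.
have le2 : nth 0 w j < nth 0 w i.
  rewrite ltn_neqAle eq_sym ne3 leqNgt; apply/negP => lt2.
  by have := no_between i j j.+1 ltij (ltnSn j) ltj lt2; lia.
case: (ltnP (nth 0 w i) (nth 0 w j.+1)) => lt3.
  by case: no2413; apply: (@contains_2413 _ i i.+1 j j.+1); lia.
by case: no3412; apply: (@contains_3412 _ i i.+1 j j.+1); lia.
Qed.

(** * Words made of two decreasing runs *)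

(** Without repeated letters, a mask can be read off from the set of letters it selects. This
    recovers the binary word from the first run. *)
Lemma map_mem_mask (T : eqType) (z : seq T) (t : seq bool) :
  uniq z -> size t = size z -> [seq x \in mask t z | x <- z] = t.
Proof.
elim: z t => [|x z IHz] [|b t] //= /andP[x_z z_uniq] [sz_t]; congr (_ :: _).
  case: b; rewrite ?mem_head //; apply/negP => /mem_mask; exact/negP.
rewrite -[RHS](IHz t) //; apply/eq_in_map => y y_z.
case: b => //; rewrite inE; case: eqP => // eq_y.
by rewrite -eq_y y_z in x_z.
Qed.

Lemma mem_mask_negb (T : eqType) (z : seq T) (t : seq bool) (x : T) :
  uniq z -> size t = size z ->
  (x \in mask (map negb t) z) = (x \in z) && (x \notin mask t z).
Proof.
move=> z_uniq sz_t; rewrite -{1}(map_mem_mask _ _ _ z_uniq sz_t) -map_comp -filter_mask.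
by rewrite mem_filter andbC.
Qed.

(** The left side keeps the positions marked by both [m] and [t], the right side those marked by
    [t]. *)
Lemma subseq_mask2 (T : eqType) (m t : seq bool) (z : seq T) :
  subseq (mask (mask m t) (mask m z)) (mask t z).
Proof.
elim: m t z => [|[] m IHm] [|b t] [|x z] //=; rewrite ?mask0 ?sub0seq //.
  by case: b => //=; rewrite ?eqxx.
case: b => //=; exact: subseq_trans (IHm t z) (subseq_cons _ _).
Qed.

(* [c] marks the letters of the increasing word [z] that go to the first run. *)
Definition two_runs (c : seq bool) (z w : seq nat) : seq nat :=
  rev (mask c z) ++ w ++ rev (mask (map negb c) z).

Lemma map_two_runs (f : nat -> nat) (c : seq bool) (z : seq nat) :
  map f (two_runs c z [::]) = two_runs c (map f z) [::].
Proof. by rewrite /two_runs !map_cat !map_rev !map_mask. Qed.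

Lemma perm_two_runs (c : seq bool) (z w : seq nat) :
  uniq z -> size c = size z -> perm_eq (two_runs c z w) (z ++ w).
Proof.
move=> z_uniq sz_c; have c_mem := map_mem_mask _ _ _ z_uniq sz_c.
have z_perm : perm_eq (mask c z ++ mask (map negb c) z) z.
  by rewrite -{2}c_mem -{1}c_mem -map_comp -!filter_mask; apply/permPl; exact: perm_filterC.
apply: perm_trans (perm_cat z_perm (perm_refl w)).
rewrite -catA; apply: perm_cat; first by rewrite perm_rev.
by rewrite perm_catC perm_cat2r perm_rev.
Qed.

Lemma sorted_rev_mask (c : seq bool) (z : seq nat) :
  sorted ltn z -> sorted gtn (rev (mask c z)).
Proof. by move=> z_sorted; rewrite rev_sorted; exact: (sorted_mask ltn_trans). Qed.

(** A decreasing word is determined by its set of letters, so each run is the reversal of the part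
    of [z] that it occupies. *)
Lemma two_runs_of_sorted (a b w z : seq nat) :
  sorted ltn z -> sorted gtn a -> sorted gtn b ->
  perm_eq (a ++ b) z -> a ++ w ++ b = two_runs [seq x \in a | x <- z] z w.
Proof.
move=> z_sorted a_sorted b_sorted ab_z.
have ab_uniq : uniq (a ++ b).
  by rewrite (perm_uniq ab_z); exact: (sorted_uniq ltn_trans ltnn).
have rev_filter (s : seq nat) : sorted gtn s -> {subset s <= z} ->
    s = rev [seq x <- z | x \in s].
  move=> s_sorted s_z; rewrite -[LHS]revK; congr rev.
  apply: (irr_sorted_eq ltn_trans ltnn).
  - by rewrite rev_sorted.
  - exact: (sorted_filter ltn_trans).
  - by move=> x; rewrite mem_rev mem_filter; case x_s: (x \in s) => //=; rewrite s_z.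
have mem_z x : (x \in z) = (x \in a) || (x \in b) by rewrite -(perm_mem ab_z) mem_cat.
rewrite /two_runs -map_comp -!filter_mask.
congr (_ ++ (_ ++ _)).
  by apply: rev_filter => // x x_a; rewrite mem_z x_a.
rewrite {1}(rev_filter b) => // [|x x_b]; last by rewrite mem_z x_b orbT.
congr rev; apply: eq_in_filter => x /=; rewrite mem_z.
move: ab_uniq; rewrite cat_uniq => /and3P[_ /hasPn disj _].
by case x_b: (x \in b); [move: (disj x x_b) => /= -> | case: (x \in a)].
Qed.


(** * The shape of the 123-avoiding Fishburn permutations *)

(** Only the letter 1 can be the bottom of an ascent, so cutting the word at 1 leaves a decreasing
    piece on each side. *)
Lemma avoiding_decomposition (m : nat) (w : seq nat) :
  perm_eq w (iota 1 m.+1) -> ~~ contains_fishburn w -> avoids [:: 1; 2; 3] w ->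
  exists2 t : seq bool, size t = m & w = two_runs t (iota 2 m) [:: 1].
Proof.
move=> w_perm /negP no_f /negP no123.
have w_uniq : uniq w by rewrite (perm_uniq w_perm) iota_uniq.
have mem_w x : (x \in w) = (0 < x < m.+2) by rewrite (perm_mem w_perm) mem_iota.
have asc i : i.+1 < size w -> nth 0 w i < nth 0 w i.+1 -> nth 0 w i = 1.
  move=> lti asci.
  have /andP[gt0 ltm] : 0 < nth 0 w i < m.+2 by rewrite -mem_w mem_nth // ltnW.
  apply/eqP/negPn/negP => neq1.
  have /(nthP 0)[/= l ltl eql] : (nth 0 w i).-1 \in w by rewrite mem_w; lia.
  have [ltli|ltil|eqli] := ltngtP l i; last by subst l; lia.
    by case: no123; apply: (@contains_123 _ l i i.+1); lia.
  have neql : l != i.+1 by apply/eqP => eq_l; move: eql; rewrite eq_l; lia.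
  case: no_f; apply/existsP; exists (Ordinal (ltnW lti)).
  by apply/existsP; exists (Ordinal ltl); apply/and3P; split=> /=; lia.
have w1 : 1 \in w by rewrite mem_w.
have lt1 : index 1 w < size w by rewrite index_mem.
have desc i : i.+1 < size w -> i != index 1 w -> nth 0 w i.+1 < nth 0 w i.
  move=> lti neqi; rewrite ltn_neqAle nth_uniq ?(ltnW lti) // gtn_eqF //= leqNgt.
  apply/negP => /(asc _ lti) eq1.
  by case/eqP: neqi; rewrite -eq1 index_uniq // ltnW.
set a := take (index 1 w) w; set b := drop (index 1 w).+1 w.
have w_eq : w = a ++ [:: 1] ++ b.
  by rewrite -{1}(cat_take_drop (index 1 w) w) (drop_nth 0) // nth_index.
exists [seq x \in a | x <- iota 2 m]; first by rewrite size_map size_iota.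
rewrite {1}w_eq; apply: two_runs_of_sorted.
- exact: iota_ltn_sorted.
- apply/(sortedP 0) => i; rewrite (size_takel (ltnW lt1)) => lti.
  by rewrite !nth_take ?(ltnW lti) //; apply: desc; lia.
- apply/(sortedP 0) => i; rewrite size_drop => lti.
  by rewrite !nth_drop addnS; apply: desc; lia.
- move: w_perm; rewrite {1}w_eq perm_catCA -[iota 1 _]/(1 :: iota 2 m) /=.
  by rewrite perm_cons.
Qed.

Lemma perm_two_runs1 (m : nat) (t : seq bool) :
  size t = m -> perm_eq (two_runs t (iota 2 m) [:: 1]) (iota 1 m.+1).
Proof.
move=> sz_t; apply: perm_trans (perm_two_runs _ _ _ (iota_uniq _ _) _) _.
  by rewrite size_iota.
by rewrite perm_catC.
Qed.

(** The letter 1 prolongs the first run, so the word is a concatenation of two decreasing words; of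
    three letters, two consecutive ones fall in the same word and descend. *)
Lemma avoids_123_two_runs (m : nat) (t : seq bool) :
  size t = m -> avoids [:: 1; 2; 3] (two_runs t (iota 2 m) [:: 1]).
Proof.
move=> sz_t; apply/negP => /containsP[u u_sub /same_relative_orderP[sz_u uP]].
move: u_sub; rewrite /two_runs catA => /subseq_catP[a [b [u_eq a_sub b_sub]]].
have a_sorted : sorted gtn a.
  apply: (subseq_sorted _ a_sub); first by move=> x y z /=; lia.
  (* The first run followed by 1 is itself a reversed mask: prefixing [true] to [t] selects the
     letter 1 of [iota 1 m.+1]. *)
  rewrite cats1 -rev_cons; apply: (sorted_rev_mask (true :: t) (iota 1 m.+1)).
  exact: iota_ltn_sorted.
have b_sorted : sorted gtn b.
  apply: (subseq_sorted _ b_sub); first by move=> x y z /=; lia.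
  by apply: sorted_rev_mask; exact: iota_ltn_sorted.
have := uP 0 1; have := uP 1 2; rewrite sz_u u_eq /= => /(_ isT isT) lt12 /(_ isT isT) lt01.
move: sz_u lt01 lt12 a_sorted b_sorted; rewrite u_eq.
case: a {a_sub u_eq} => [|x [|y a]] /=.
- by case: b b_sub => [|x [|y b]] //= _ _ lt01 _ _ /andP[]; lia.
- by case: b b_sub => [|y [|v b]] //= _ _ _ lt12 _ /andP[]; lia.
- by move=> _ lt01 _ /andP[]; lia.
Qed.

(** No ascent lies inside a decreasing word, so it straddles the boundary and thereby fixes the
    length of [a]. *)
Lemma ascent_cat (a b : seq nat) (j : nat) :
  sorted gtn a -> sorted gtn b -> j.+1 < size (a ++ b) ->
  nth 0 (a ++ b) j < nth 0 (a ++ b) j.+1 -> size a = j.+1.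
Proof.
move=> /(sortedP 0) a_sorted /(sortedP 0) b_sorted; rewrite size_cat !nth_cat => ltj.
have [ltja|leaj] := ltnP j.+1 (size a).
  by rewrite (ltnW ltja); have := a_sorted j ltja; rewrite /=; lia.
have [ltja _|leaj'] := ltnP j (size a); first by apply/eqP; rewrite eqn_leq leaj.
have ltb : (j - size a).+1 < size b by lia.
by rewrite subSn //; have := b_sorted _ ltb; rewrite /=; lia.
Qed.

(** An ascent can only start at the letter 1, and a copy of the Fishburn pattern would then need the
    letter 0. *)
Lemma avoids_fishburn_two_runs (m : nat) (t : seq bool) :
  size t = m -> ~~ contains_fishburn (two_runs t (iota 2 m) [:: 1]).
Proof.
move=> sz_t; set w := two_runs _ _ _.
have mem_w x : (x \in w) = (0 < x < m.+2).
  by rewrite (perm_mem (perm_two_runs1 _ _ sz_t)) mem_iota.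
apply/existsP => -[[j ltj] /existsP[[l ltl] /and3P[/= ltjl /eqP eqj asc]]].
have gt0 : 0 < nth 0 w l by have := mem_nth 0 ltl; rewrite mem_w => /andP[].
have ltj' : j.+1 < size w by exact: ltn_trans ltjl ltl.
have sz_a : size (rev (mask t (iota 2 m)) ++ [:: 1]) = j.+1.
  apply: (@ascent_cat _ (rev (mask (map negb t) (iota 2 m)))); rewrite -?catA //.
    rewrite cats1 -rev_cons; apply: (sorted_rev_mask (true :: t) (iota 1 m.+1)).
    exact: iota_ltn_sorted.
  by apply: sorted_rev_mask; exact: iota_ltn_sorted.
move: sz_a; rewrite size_cat addn1 => -[sz_a].
have eq1 : nth 0 w j = 1 by rewrite /w /two_runs nth_cat -sz_a ltnn subnn.
by move: eqj; rewrite eq1; lia.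
Qed.

(** * The shape of a restrictive pattern *)

(** The copy of [f] provides an ascent at [i], and every other step descends by [unique_ascent]. Its
    third letter, at [l], is kept as a witness that the ascent bottom is not the least letter. *)
Lemma restrictive_decomposition (k : nat) (s : seq nat) :
  perm_eq s (iota 1 k) -> avoids [:: 1; 2; 3] s -> contains_fishburn s ->
  avoids [:: 2; 4; 1; 3] s -> avoids [:: 3; 4; 1; 2] s ->
  exists c i l, [/\ size c = k, s = two_runs c (iota 1 k) [::], i.+1 < k, l < k &
    [/\ size (mask c (iota 1 k)) = i.+1, nth 0 s i < nth 0 s i.+1
      & nth 0 s l < nth 0 s i]].
Proof.
move=> s_perm no123 /existsP[[i lti] /existsP[[l ltl] /and3P[/= ltil /eqP eqi asc]]].
move=> no2413 no3412.
have s_uniq : uniq s by rewrite (perm_uniq s_perm) iota_uniq.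
have sz_s : size s = k by rewrite (perm_size s_perm) size_iota.
have lti' : i.+1 < size s by exact: ltn_trans ltil ltl.
have desc j : j.+1 < size s -> j != i -> nth 0 s j.+1 < nth 0 s j.
  move=> ltj neqj; rewrite ltn_neqAle nth_uniq ?(ltnW ltj) // gtn_eqF //= leqNgt.
  apply/negP => ascj; have [ltji|ltij|eqji] := ltngtP j i.
  - exact: (@unique_ascent s j i).
  - exact: (@unique_ascent s i j).
  - by rewrite eqji eqxx in neqj.
set c := [seq x \in take i.+1 s | x <- iota 1 k].
have s_eq : s = two_runs c (iota 1 k) [::].
  rewrite -{1}(cat_take_drop i.+1 s) -[drop _ _]cat0s; apply: two_runs_of_sorted.
  - exact: iota_ltn_sorted.
  - apply/(sortedP 0) => j; rewrite size_takel // => ltj.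
    by rewrite !nth_take ?(ltnW ltj) //; apply: desc; lia.
  - apply/(sortedP 0) => j; rewrite size_drop => ltj.
    by rewrite !nth_drop addnS; apply: desc; lia.
  - by rewrite cat_take_drop.
exists c, i, l; split=> //; rewrite -?sz_s //; first by rewrite size_map size_iota sz_s.
split=> //; last by lia.
rewrite sz_s -filter_mask -[RHS](size_takel lti); apply/perm_size/uniq_perm.
- by rewrite filter_uniq ?iota_uniq.
- by rewrite take_uniq.
- move=> x; rewrite mem_filter -(perm_mem s_perm).
  by case x_s: (x \in take _ _) => //=; rewrite (mem_take x_s).
Qed.

(** * Occurrences of a pattern as subsequences of binary words *)

(** The mask [M] that extracts [c] from [t] also extracts letters from [iota 2 m]; arranged in two
    runs by [c], they form an occurrence that skips the letter 1. *)
Lemma contains_two_runs_of_subseq (k m : nat) (c t : seq bool) :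
  size c = k -> size t = m -> subseq c t ->
  contains (two_runs c (iota 1 k) [::]) (two_runs t (iota 2 m) [:: 1]).
Proof.
move=> sz_c sz_t /subseqP[M sz_M c_eq]; set z := iota 2 m.
apply/containsP; exists (two_runs c (mask M z) [::]).
  rewrite /two_runs; apply: cat_subseq; last apply: cat_subseq.
  - by rewrite subseq_rev c_eq subseq_mask2.
  - exact: sub0seq.
  - by rewrite subseq_rev c_eq map_mask subseq_mask2.
have sz_Mz : size (mask M z) = k.
  by rewrite -sz_c c_eq !size_mask // size_iota sz_M.
have z_sorted : sorted ltn (mask M z).
  by apply: (sorted_mask ltn_trans); exact: iota_ltn_sorted.
(* Both words become images of [two_runs c (iota 0 k) [::]] under maps increasing on its letters,
   hence have the same relative order. *)
have -> : iota 1 k = map (addn 1) (iota 0 k) by rewrite -iotaDl.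
have -> : mask M z = map (nth 0 (mask M z)) (iota 0 k) by rewrite -sz_Mz map_nth_iota0 // take_size.
rewrite -!map_two_runs; apply: same_relative_order_map => x y.
rewrite !(perm_mem (perm_two_runs _ _ _ (iota_uniq _ _) _)) ?size_iota // cats0.
rewrite !mem_iota !add0n /= => ltx lty; rewrite ltn_add2l.
have nth_lt := sorted_ltn_nth ltn_trans 0 z_sorted.
have [ltxy|ltyx|->] := ltngtP x y; last by rewrite ltnn.
  by apply: nth_lt => //; rewrite inE sz_Mz.
by apply/negbTE; rewrite -leqNgt ltnW //; apply: nth_lt => //; rewrite inE sz_Mz.
Qed.

(** The ascent of the occurrence must straddle the cut just after the letter 1, which sends the two
    runs of the pattern into the two runs of the host. Each letter used then carries the same bit in
    [c] and in [t]. *)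
Lemma subseq_of_contains_two_runs (k m i l : nat) (c t : seq bool) :
  size c = k -> size t = m ->
  let s := two_runs c (iota 1 k) [::] in
  i.+1 < k -> l < k -> size (mask c (iota 1 k)) = i.+1 ->
  nth 0 s i < nth 0 s i.+1 -> nth 0 s l < nth 0 s i ->
  contains s (two_runs t (iota 2 m) [:: 1]) -> subseq c t.
Proof.
move=> sz_c sz_t s lti ltl sz_run asc low /containsP[u u_sub].
case/same_relative_orderP => sz_u uP; set z := iota 2 m in u_sub *.
have s_perm : perm_eq s (iota 1 k).
  by rewrite -[iota 1 k]cats0; apply: perm_two_runs; rewrite ?size_iota ?iota_uniq.
have s_uniq : uniq s by rewrite (perm_uniq s_perm) iota_uniq.
have sz_s : size s = k by rewrite (perm_size s_perm) size_iota.
have z_uniq : uniq z := iota_uniq _ _.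
have sz_z : size t = size z by rewrite size_iota.
(* [g] sends a letter of the pattern to the letter of the occurrence in the same position; [z']
   lists the latter letters in increasing order. *)
pose g x := nth 0 u (index x s); pose z' := map g (iota 1 k).
have u_eq : u = two_runs c z' [::].
  rewrite -map_two_runs -/s.
  apply: (@eq_from_nth _ 0); rewrite ?size_map // => j ltj.
  by rewrite (nth_map 0) -?sz_u // /g index_uniq // -sz_u.
have z'_sorted : sorted ltn z'.
  rewrite sorted_map; apply: (@sub_in_sorted _ [in s] ltn); last exact: iota_ltn_sorted.
    move=> x y x_s y_s ltxy; rewrite /= /g uP ?sz_u ?index_mem //.
    by rewrite !nth_index.
  by apply/allP => x; rewrite -(perm_mem s_perm).
have z'_uniq : uniq z' by exact: (sorted_uniq ltn_trans ltnn).
have sz_z' : size c = size z' by rewrite size_map size_iota.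
have u_pos j : j < k -> 0 < nth 0 u j.
  rewrite -sz_s -sz_u => ltj; have := mem_subseq u_sub (mem_nth 0 ltj).
  by rewrite (perm_mem (perm_two_runs1 _ _ sz_t)) mem_iota => /andP[].
(* The image of the letter at [l] is positive and lies below the ascent bottom. *)
have u_low : 1 < nth 0 u i.
  apply: leq_ltn_trans (u_pos l ltl) _.
  by rewrite uP // sz_u sz_s // ltnW.
have u_asc : nth 0 u i < nth 0 u i.+1 by rewrite uP // sz_u sz_s // ltnW.
move: u_sub; rewrite {1}/two_runs catA => /subseq_catP[a [b [u_cat a_sub b_sub]]].
have sz_a : size a = i.+1.
  apply: (@ascent_cat _ b); rewrite -?u_cat ?sz_u ?sz_s //.
    apply: (subseq_sorted _ a_sub); first by move=> x y v /=; lia.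
    rewrite cats1 -rev_cons; apply: (sorted_rev_mask (true :: t) (iota 1 m.+1)).
    exact: iota_ltn_sorted.
  apply: (subseq_sorted _ b_sub); first by move=> x y v /=; lia.
  by apply: sorted_rev_mask; exact: iota_ltn_sorted.
(* The letter 1 could only be the last letter of [a], at index [i], where [u_low] excludes it. *)
have a_sub' : subseq a (rev (mask t z)).
  case/subseq_catP: a_sub => a1 [[|x [|y a2]]] [a_eq a1_sub] /=.
  - by rewrite a_eq cats0.
  - case: (x =P 1) => // x1 _; move: u_low; rewrite u_cat nth_cat sz_a ltnSn a_eq nth_cat.
    by move: sz_a; rewrite a_eq size_cat addn1 => -[->]; rewrite ltnn subnn /= x1.
  - by case: (x == 1).
(* Both factorizations of [u] have a first factor of length [i.+1], so they coincide. *)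
have /andP[/eqP a_eq /eqP b_eq] : (a == rev (mask c z')) && (b == rev (mask (map negb c) z')).
  rewrite -eqseq_cat; first by rewrite -u_cat u_eq /two_runs.
  by rewrite sz_a size_rev -sz_run /z' !size_mask // ?size_map ?size_iota.
have run1 x : x \in mask c z' -> x \in mask t z.
  by rewrite -mem_rev -a_eq => /(mem_subseq a_sub'); rewrite mem_rev.
have run2 x : x \in mask (map negb c) z' -> x \in mask (map negb t) z.
  by rewrite -mem_rev -b_eq => /(mem_subseq b_sub); rewrite mem_rev.
have z'_z x : x \in z' -> (x \in z) && ((x \in mask c z') == (x \in mask t z)).
  move=> x_z'; case x_c: (x \in mask c z'); first by rewrite run1 // (mem_mask (run1 x x_c)).
  have := run2 x; rewrite !mem_mask_negb // x_z' x_c => /(_ isT) /andP[-> /negbTE ->].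
  by rewrite eqxx.
have z'_sub : subseq z' z.
  have -> : z' = [seq x <- z | x \in z'].
    apply: (irr_sorted_eq ltn_trans ltnn) => //.
      by apply: (sorted_filter ltn_trans); exact: iota_ltn_sorted.
    by move=> x; rewrite mem_filter; case x_z': (x \in z') => //=; case/andP: (z'_z x x_z').
  exact: filter_subseq.
(* Both [t] and [c] become lists of membership bits for [mask t z], taken along [z] and its
   subsequence [z']. *)
rewrite -(map_mem_mask _ _ _ z_uniq sz_z) -(map_mem_mask _ _ _ z'_uniq sz_z').
have -> : [seq x \in mask c z' | x <- z'] = [seq x \in mask t z | x <- z'].
  by apply/eq_in_map => x x_z'; apply/eqP; case/andP: (z'_z x x_z').
exact: map_subseq.
Qed.

(** * Counting binary words that avoid a subsequence *)

Lemma sum_tupleS (T : finType) (m : nat) (F : m.+1.-tuple T -> nat) :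
  \sum_t F t = \sum_(x : T) \sum_(t : m.-tuple T) F [tuple of x :: t].
Proof.
rewrite pair_big /= (reindex (fun p : T * m.-tuple T => [tuple of p.1 :: p.2])) //.
exists (fun t : m.+1.-tuple T => (thead t, [tuple of behead t])) => [[x t] _|t _] /=.
  by congr (_, _); apply: val_inj.
by rewrite [RHS]tuple_eta.
Qed.

(** Induction on [m]: a word starting with [b] avoids [b :: c] iff its tail avoids [c], and any
    other word iff its tail avoids [b :: c]. The recurrence does not depend on the value of [b] and
    matches Pascal's rule. *)
Lemma card_not_subseq (m : nat) (c : seq bool) :
  #|[set t : m.-tuple bool | ~~ subseq c t]| = \sum_(0 <= j < size c) 'C(m, j).
Proof.
have -> : #|[set t : m.-tuple bool | ~~ subseq c t]|
    = \sum_(t : m.-tuple bool) ~~ subseq c t.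
  by rewrite -sum1_card big_mkcond; apply: eq_bigr => t _; rewrite inE; case: subseq.
elim: m c => [|m IHm] [|b c].
- by rewrite big_geq // big1 // => t _; rewrite sub0seq.
- rewrite big_nat_recl // [X in _ = _ + X]big1 // addn0.
  rewrite (eq_bigr (fun=> 1)) => [|t _]; last by rewrite tuple0.
  by rewrite sum1_card card_tuple.
- by rewrite big_geq // big1 // => t _; rewrite sub0seq.
have -> : \sum_(t : m.+1.-tuple bool) ~~ subseq (b :: c) t
    = \sum_(t : m.-tuple bool) ~~ subseq (b :: c) t + \sum_(t : m.-tuple bool) ~~ subseq c t.
  by rewrite sum_tupleS big_bool; case: b => /=; rewrite // addnC.
rewrite !IHm /= big_nat_recl // [in RHS]big_nat_recl //=.
under [in RHS]eq_bigr do rewrite binS.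
by rewrite big_split /= !bin0 addnA.
Qed.

(** * One-line notation and the final count *)

Lemma one_line_inj (n : nat) : injective (@one_line n).
Proof.
move=> p q /eq_in_map pq; apply/permP => i; apply: val_inj.
by case: (pq i (mem_enum _ i)).
Qed.

Lemma perm_one_line (n : nat) (p : 'S_n) : perm_eq (one_line p) (iota 1 n).
Proof.
have -> : one_line p = [seq x.+1 | x <- [seq val i | i <- [seq p i | i <- enum 'I_n]]].
  by rewrite -2!map_comp.
rewrite [iota 1 n](iotaDl 1 0 n) -val_enum_ord; apply/perm_map/perm_map.
apply: uniq_perm; rewrite ?(map_inj_uniq perm_inj) ?enum_uniq // => i.
rewrite mem_enum; apply/mapP; by exists (p^-1 i)%g; rewrite ?mem_enum ?permKV.
Qed.

Lemma one_line_surj (n : nat) (w : seq nat) :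
  perm_eq w (iota 1 n.+1) -> exists p : 'S_n.+1, one_line p = w.
Proof.
move=> w_perm; have sz_w : size w = n.+1 by rewrite (perm_size w_perm) size_iota.
have w_uniq : uniq w by rewrite (perm_uniq w_perm) iota_uniq.
have w_val (i : 'I_n.+1) : 0 < nth 0 w i < n.+2.
  by rewrite -mem_iota -(perm_mem w_perm) mem_nth // sz_w.
(* The predecessor undoes the shift of letters in [one_line]; [inord] requires the nonempty type
   ['I_n.+1]. *)
pose f (i : 'I_n.+1) : 'I_n.+1 := inord (nth 0 w i).-1.
have f_val i : (f i).+1 = nth 0 w i.
  by have /andP[gt0 lti] := w_val i; rewrite inordK prednK.
have f_inj : injective f.
  move=> i j eqf; apply/val_inj/eqP; rewrite -(nth_uniq 0 _ _ w_uniq) ?sz_w ?ltn_ord //.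
  by rewrite -!f_val eqf.
exists (perm f_inj); apply: (@eq_from_nth _ 0); rewrite size_map size_enum_ord ?sz_w //.
move=> j ltj; rewrite (nth_map ord0) ?size_enum_ord // permE f_val.
by rewrite nth_enum_ord.
Qed.

Theorem proposition6p7 (k : nat) (hk : 3 <= k) (sigma : 'S_k)
    (hsigma : restrictive sigma) (n : nat) :
  #|fishburn_avoiding n [:: [:: 1; 2; 3]; one_line sigma]|
    = \sum_(0 <= j < k) bin_pred n j.
Proof.
have [no123 f_in no2413 no3412] := and4P hsigma.
have [c [i [l [sz_c sigma_eq lti ltl [sz_run asc low]]]]] :=
  restrictive_decomposition _ _ (perm_one_line _ sigma) no123 f_in no2413 no3412.
(* For length 0 the empty permutation is the only one and avoids everything; on the right only the
   term [j = 0] survives. *)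
case: n => [|m].
  have -> : fishburn_avoiding 0 [:: [:: 1; 2; 3]; one_line sigma] = setT.
    have empty (p : 'S_0) : one_line p = [::].
      by apply: size0nil; rewrite size_map size_enum_ord.
    have avoids0 s : s != [::] -> avoids s [::].
      move=> s_neq0; apply/negP => /containsP[u]; rewrite subseq0 => /eqP ->.
      by case/same_relative_orderP => /esym/size0nil s0; rewrite s0 in s_neq0.
    apply/setP => p; rewrite !inE empty /= !avoids0 ?andbT //.
      by apply/existsP => -[[]].
    by rewrite -size_eq0 size_map size_enum_ord; lia.
  rewrite cardsT card_Sn -(prednK (ltn_trans (ltn0Sn i) lti)) big_nat_recl // big1 //.
(* As [k] is the length of [c], the right side counts the binary words of length [m] without the
   subsequence [c]; [F] will biject them with the permutations. *)
rewrite -{2}sz_c -card_not_subseq.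
have /fin_all_exists[F FE] (t : m.-tuple bool) :
    exists p : 'S_m.+1, one_line p = two_runs t (iota 2 m) [:: 1].
  by apply: one_line_surj; apply: perm_two_runs1; exact: size_tuple.
have F_inj : injective F.
  move=> t t' eqF.
  (* The first run is whatever precedes the letter 1, so it depends only on the permutation. *)
  have eq_run : mask t (iota 2 m) = mask t' (iota 2 m).
    apply: (can_inj revK).
    have run (x : m.-tuple bool) :
        rev (mask x (iota 2 m)) = take (index 1 (one_line (F x))) (one_line (F x)).
      rewrite FE /two_runs index_cat mem_rev ifN ?addn0 ?take_size_cat //.
      by apply/negP => /mem_mask; rewrite mem_iota.
    by rewrite !run eqF.
  apply: val_inj; rewrite /= -[LHS](map_mem_mask _ (iota 2 m)) ?iota_uniq ?size_iota ?size_tuple //.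
  by rewrite eq_run map_mem_mask ?iota_uniq ?size_iota ?size_tuple.
rewrite -(card_imset _ F_inj); apply: eq_card => p; rewrite !inE /= andbT.
have containsE (t : m.-tuple bool) : contains (one_line sigma) (one_line (F t)) = subseq c t.
  rewrite FE sigma_eq; apply/idP/idP; last first.
    exact: (contains_two_runs_of_subseq _ _ _ _ sz_c (size_tuple t)).
  rewrite sigma_eq in asc low.
  exact: (subseq_of_contains_two_runs k m i l c t sz_c (size_tuple t)).
apply/and3P/imsetP => [[no_f p_no123 no_sigma]|[t]].
  have [t sz_t p_eq] := avoiding_decomposition _ _ (perm_one_line _ p) no_f p_no123.
  have eqp : p = F (Tuple (introT eqP sz_t)) by apply: one_line_inj; rewrite FE.
  by exists (Tuple (introT eqP sz_t)) => //; rewrite inE -containsE -eqp.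
rewrite inE -containsE => no_sigma ->; split=> //; rewrite FE.
  exact: avoids_fishburn_two_runs _ _ (size_tuple t).
exact: avoids_123_two_runs _ _ (size_tuple t).
Qed.
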